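(* Let $X=(X_1,\dots,X_n):\Omega\to\mathbb{R}^n$ be an uncertain variable, $f:[\![X]\!]\to\mathbb{R}^q$ a query, and $\mathfrak{M}:\mathbb{R}^q\to\mathbb{R}^q$ a mapping such that $\mathfrak{M}\circ f$ is $\epsilon$-noiselessly private, $\epsilon>0$. Then $g\circ\mathfrak{M}\circ f$ is also $\epsilon$-noiselessly private for any mapping $g$ (defined on $\mathbb{R}^q$).
   Context: An uncertain variable is a map on a nonempty set $\Omega$ (no measure assumed); $[\![X]\!]=\{X(\omega):\omega\in\Omega\}$ is its range. $x_{-i}$, $X_{-i}$ denote vectors with the $i$-th entry removed. A mechanism $m$ defined on $[\![X]\!]$ is $\epsilon$-noiselessly private, $\epsilon>0$, if, with $Y=m\circ X$, the set $[\![Y|X_{-i}(\omega)=x_{-i}]\!]=\{Y(\omega):\omega\in\Omega,\ X_{-i}(\omega)=x_{-i}\}$ has at most $2^\epsilon$ elements for all $i\in\{1,\dots,n\}$ and all $x_{-i}\in[\![X_{-i}]\!]$. *)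

(* Defs.v *)
(* MathComp-Analysis world: R is an arbitrary realType, R^n is 'rV[R]_n. *)
From mathcomp Require Export all_boot all_order all_algebra.
From mathcomp Require Export all_classical all_reals all_analysis.

Set Implicit Arguments.
Unset Strict Implicit.
Unset Printing Implicit Defensive.

Import Order.TTheory GRing.Theory Num.Theory.

Local Open Scope classical_set_scope.
Local Open Scope ring_scope.

(* An uncertain variable X is a plain map on the sample space and [[X]] is
   `range X`; no measure or measurability is involved. *)

(* X with its codomain restricted to [[X]], so that it can be composed with
   maps that are only defined on [[X]]. *)
Definition to_range (Omega T : Type) (X : Omega -> T) (w : Omega) : range X :=
  SigSub (mem_set (imageT X w)).

(* X_{-i}; `col' i` deletes the i-th entry of a row vector. *)
Definition others (R : realType) (Omega : Type) (n : nat)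
    (X : Omega -> 'rV[R]_n) (i : 'I_n) : Omega -> 'rV[R]_n.-1 :=
  fun w => col' i (X w).

(* [[Y | Z = z]] *)
Definition cond_range (Omega T U : Type)
    (Y : Omega -> T) (Z : Omega -> U) (z : U) : set T :=
  [set Y w | w in [set w | Z w = z]].

(* A is finite and its number of elements k satisfies k <= r. *)
Definition at_most (R : realType) (T : Type) (A : set T) (r : R) : Prop :=
  exists k : nat, (A #= `I_k)%card /\ k%:R <= r.

Definition noiselessly_private (R : realType) (Omega T : Type) (n : nat)
    (X : Omega -> 'rV[R]_n) (eps : R) (m : range X -> T) : Prop :=
  forall (i : 'I_n) (x : 'rV[R]_n.-1), range (others X i) x ->
    at_most (cond_range (m \o to_range X) (others X i) x) (2 `^ eps).
Arguments noiselessly_private {R Omega T n} X eps m.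

(* Main.v *)
Require Import Defs.
Import Order.TTheory GRing.Theory Num.Theory.
Local Open Scope classical_set_scope.
Local Open Scope ring_scope.

(** With all entries but the i-th fixed, the outputs of [g \o M \o f] are exactly the images under
    [g] of those of [M \o f]. A map never increases the size of a finite set, so the same bound
    survives. *)

Lemma at_most_image (R : realType) (T U : Type) (g : T -> U) (A : set T)
  (r : R) : at_most A r -> at_most (g @` A) r.
Proof.
move=> [k [Ak kr]].
have /finite_setP[l gAl] : finite_set (g @` A).
  by apply: finite_image; apply/finite_setP; exists k.
(* [g] may merge points, so the image has its own size [l]; [l <= k] is obtained by comparing
   cardinals. *)
exists l; split=> //; apply: le_trans kr; rewrite ler_nat -card_le_II.
by rewrite -(card_le_eql gAl) -(card_le_eqr Ak) card_image_le.
Qed.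

Theorem theorem7 (R : realType) (Omega : Type) (Omega_nonempty : inhabited Omega)
  (n q : nat) (X : Omega -> 'rV[R]_n) (f : range X -> 'rV[R]_q)
  (M : 'rV[R]_q -> 'rV[R]_q) (eps : R) (eps_gt0 : 0 < eps) :
  noiselessly_private X eps (M \o f) ->
  forall (T : Type) (g : 'rV[R]_q -> T),
    noiselessly_private X eps (g \o M \o f).
Proof.
move=> Mf T g i x /Mf /(@at_most_image _ _ _ g).
(* A conditional range is itself an image, so its image under [g] is that of the composite map. *)
by rewrite /cond_range image_comp.
Qed.
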